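(* Let $k$ be an arbitrary field, let $Q,Q'$ be quivers with weights $\theta,\theta'$ and dimension vectors $d,d'$, and let $\overline{\theta}=(\theta_a+\theta'_{a'})_{(a,a')}$ and $\bar d=(d_ad'_{a'})_{(a,a')}$. Identify $\tilde Q\otimes\tilde{Q'}$ with a subquiver of $\widetilde{Q\otimes Q'}$ via the embedding $\phi$, and let $\mathbf{U}$ and $\mathbf{I}$ be the corresponding forgetful and extension-by-zero functors between their categories of representations. If $V$ and $W$ are representations of $Q$ and $Q'$ of types $d$ and $d'$ respectively, then: (1) If $\mathbf{U}(\widetilde{V\otimes W})$ is semistable, then so is $\widetilde{V\otimes W}$. (2) $\mathbf{I}(\tilde V\otimes\tilde W)$ is semistable if and only if $\widetilde{V\otimes W}$ is semistable. Here semistability of representations of $\widetilde{Q\otimes Q'}$ and of $\tilde Q\otimes\tilde{Q'}$ is with respect to the weight whose value at a vertex lying over $(a,a')\in Q_0\times Q'_0$ is $\theta_a+\theta'_{a'}$.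
   Context: A quiver $Q=(Q_0,Q_1,\mathrm{s},\mathrm{t})$ consists of finite sets $Q_0\neq\emptyset$, $Q_1$ and maps $\mathrm{s},\mathrm{t}:Q_1\to Q_0$. A representation over $k$ is a family $(V_a)_{a\in Q_0}$ of finite-dimensional vector spaces with linear maps $\rho_\alpha:V_{\mathrm{s}(\alpha)}\to V_{\mathrm{t}(\alpha)}$; its type is $(\dim V_a)_a$. For a weight $\theta\in\mathbf{R}^{Q_0}$, $\mu_\theta(V)=\left(\sum_a\theta_a\dim V_a\right)/\left(\sum_a\dim V_a\right)$; a non-zero representation is $\theta$-semistable if every non-zero proper subrepresentation has slope $\le\mu_\theta(V)$. The internal product $Q\otimes Q'$ has vertices $Q_0\times Q_0'$ and arrows $(Q_0\times Q_1')\sqcup(Q_1\times Q_0')$, with $(a,\alpha')$ going from $(a,\mathrm{s}(\alpha'))$ to $(a,\mathrm{t}(\alpha'))$ and $(\alpha,a')$ from $(\mathrm{s}(\alpha),a')$ to $(\mathrm{t}(\alpha),a')$. The tensor product of representations $(V,\rho)$ of $Q$ and $(W,\sigma)$ of $Q'$ is the representation of $Q\otimes Q'$ with spaces $V_a\otimes W_{a'}$ and maps $\mathbf{1}_{V_a}\otimes\sigma_{\alpha'}$ for $(a,\alpha')$ and $\rho_\alpha\otimes\mathbf{1}_{W_{a'}}$ for $(\alpha,a')$. The covering quiver $\tilde Q$ of $Q$ with respect to $d$ has vertices $(a,\mu)$, $a\in Q_0$, $1\le\mu\le d_a$, and arrows $(\alpha,\mu,\nu)$, $\alpha\in Q_1$,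 $1\le\mu\le d_{\mathrm{s}(\alpha)}$, $1\le\nu\le d_{\mathrm{t}(\alpha)}$, going from $(\mathrm{s}(\alpha),\mu)$ to $(\mathrm{t}(\alpha),\nu)$. $\tilde{Q'}$ and $\widetilde{Q\otimes Q'}$ are the covering quivers with respect to $d'$ and $\bar d$. Given ordered bases of the $V_a$, the covering representation $\tilde V$ of $\tilde Q$ has $\tilde V_{(a,\mu)}$ the line spanned by the $\mu$-th basis vector of $V_a$, and $\tilde\rho_{(\alpha,\mu,\nu)}$ the $(\mu,\nu)$-th matrix entry of $\rho_\alpha$ (component from the $\mu$-th basis line of $V_{\mathrm{s}(\alpha)}$ to the $\nu$-th basis line of $V_{\mathrm{t}(\alpha)}$). Similarly for $\tilde W$ and $\widetilde{V\otimes W}$. The embedding $\phi=(\phi_0,\phi_1):\tilde Q\otimes\tilde{Q'}\to\widetilde{Q\otimes Q'}$: for each $(a,a')$ fix a bijection $f_{a,a'}:\{1,\dots,d_a\}\times\{1,\dots,d'_{a'}\}\to\{1,\dots,d_ad'_{a'}\}$, and set $\phi_0((a,\mu),(a',\mu'))=((a,a'),f_{a,a'}(\mu,\mu'))$, $\phi_1((a,\mu),(\alpha',\mu',\nu'))=((a,\alpha'),f_{a,\mathrm{s}(\alpha')}(\mu,\mu'),f_{a,\mathrm{t}(\alpha')}(\mu,\nu'))$, $\phi_1((\alpha,\mu,\nu),(a',\mu'))=((\alpha,a'),f_{\mathrm{s}(\alpha),a'}(\mu,\mu'),f_{\mathrm{t}(\alpha),a'}(\nu,\mu'))$. It is bijective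 on vertices and injective on arrows. Fixed ordered bases of $V_a$ and $W_{a'}$ are used, and $V_a\otimes W_{a'}$ is given the basis whose $f_{a,a'}(\mu,\mu')$-th element is the tensor product of the $\mu$-th basis element of $V_a$ and the $\mu'$-th basis element of $W_{a'}$. $\mathbf{U}$ sends a representation of $\widetilde{Q\otimes Q'}$ to its restriction to the arrows of the subquiver $\tilde Q\otimes\tilde{Q'}$ (same vector spaces); $\mathbf{I}$ extends a representation of $\tilde Q\otimes\tilde{Q'}$ to $\widetilde{Q\otimes Q'}$ by zero maps on the remaining arrows. *)

(* Defs.v *)
From HB Require Import structures.
From mathcomp Require Import all_boot all_order all_algebra.
From mathcomp Require Import reals.

Set Implicit Arguments.
Unset Strict Implicit.
Unset Printing Implicit Defensive.

Import Order.TTheory GRing.Theory Num.Theory.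
Local Open Scope ring_scope.

Section BijInv.
Variables (S T : finType) (f : S -> T).
Hypothesis f_bij : bijective f.

Lemma bij_codom y : y \in codom f.
Proof. by case: f_bij => g _ gK; rewrite -(gK y) codom_f. Qed.

Definition bij_inv (y : T) : S := iinv (bij_codom y).

Lemma bij_invK : cancel bij_inv f.
Proof. by move=> y; rewrite /bij_inv f_iinv. Qed.

Lemma bij_invKV : cancel f bij_inv.
Proof. by move=> x; apply: (bij_inj f_bij); rewrite bij_invK. Qed.

End BijInv.

(* The vertex set may be empty: a covering quiver has no vertices when the
   dimension vector is zero.  Non-emptiness is a separate hypothesis. *)
Record quiver := Quiver {
  qvert : finType;
  qarr : finType;
  qsrc : qarr -> qvert;
  qtgt : qarr -> qvert
}.

Record qrep (k : fieldType) (Q : quiver) := QRep {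
  rspace : qvert Q -> vectType k;
  rmap : forall al : qarr Q, 'Hom(rspace (qsrc al), rspace (qtgt al))
}.

Definition has_type (k : fieldType) (Q : quiver) (V : qrep k Q)
    (d : qvert Q -> nat) : Prop :=
  forall a, \dim {:rspace V a} = d a.

Definition slope (R : realType) (Q : quiver) (theta : qvert Q -> R)
    (n : qvert Q -> nat) : R :=
  (\sum_a theta a * (n a)%:R) / (\sum_a (n a)%:R).

Definition is_subrep (k : fieldType) (Q : quiver) (V : qrep k Q)
    (U : forall a, {vspace rspace V a}) : Prop :=
  forall al : qarr Q, (rmap V al @: U (qsrc al) <= U (qtgt al))%VS.

Definition semistable (R : realType) (k : fieldType) (Q : quiver)
    (theta : qvert Q -> R) (V : qrep k Q) : Prop :=
  (exists a, {:rspace V a}%VS != 0%VS) /\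
  forall U : forall a, {vspace rspace V a},
    is_subrep U ->
    (exists a, U a != 0%VS) ->
    (exists a, U a != {:rspace V a}%VS) ->
    slope theta (fun a => \dim (U a)) <=
    slope theta (fun a => \dim {:rspace V a}).

(* The tensor product of finite-dimensional spaces, realised as Hom(V^*, W);
   the pure tensor v (x) w is the map h |-> h v *: w. *)
Section Tensor.
Variable k : fieldType.

Definition dualsp (V : vectType k) : vectType k := 'Hom(V, k^o).

Definition tens_space (V W : vectType k) : vectType k := 'Hom(dualsp V, W).

Definition tens (V W : vectType k) (v : V) (w : W) : tens_space V W :=
  linfun (fun h : dualsp V => (h : 'Hom(V, k^o)) v *: w).

Definition dual_map (V V' : vectType k) (g : 'Hom(V, V')) :
    'Hom(dualsp V', dualsp V) :=
  linfun (fun h : dualsp V' => ((h : 'Hom(V', k^o)) \o g)%VF : dualsp V).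

Definition tens_map (V V' W W' : vectType k)
    (g : 'Hom(V, V')) (h : 'Hom(W, W')) :
    'Hom(tens_space V W, tens_space V' W') :=
  linfun (fun T : tens_space V W =>
    (h \o (T : 'Hom(dualsp V, W)) \o dual_map g)%VF : tens_space V' W').

Lemma tensE (V W : vectType k) (v : V) (w : W) (h : dualsp V) :
  (tens v w : 'Hom(dualsp V, W)) h = (h : 'Hom(V, k^o)) v *: w.
Proof.
pose F (h : dualsp V) := (h : 'Hom(V, k^o)) v *: w.
have lF : linear F.
  by move=> c x y; rewrite /F add_lfunE scale_lfunE scalerDl scalerA.
pose L := GRing.isLinear.Build _ _ _ _ F lF.
pose FL : {linear _ -> _} := HB.pack F L.
exact: (lfunE FL).
Qed.

Lemma dual_mapE (V V' : vectType k) (g : 'Hom(V, V')) (h : dualsp V') :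
  dual_map g h = ((h : 'Hom(V', k^o)) \o g)%VF.
Proof.
pose F (h : dualsp V') := ((h : 'Hom(V', k^o)) \o g)%VF : dualsp V.
have lF : linear F.
  move=> c x y; apply/lfunP=> v.
  by rewrite comp_lfunE !add_lfunE !scale_lfunE !comp_lfunE.
pose L := GRing.isLinear.Build _ _ _ _ F lF.
pose FL : {linear _ -> _} := HB.pack F L.
exact: (lfunE FL).
Qed.

Lemma tens_mapE (V V' W W' : vectType k) (g : 'Hom(V, V')) (h : 'Hom(W, W'))
    (T : tens_space V W) :
  tens_map g h T = (h \o (T : 'Hom(dualsp V, W)) \o dual_map g)%VF.
Proof.
pose F (T : tens_space V W) :=
  (h \o (T : 'Hom(dualsp V, W)) \o dual_map g)%VF : tens_space V' W'.
have lF : linear F.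
  move=> c x y; apply/lfunP=> v.
  by rewrite add_lfunE scale_lfunE !comp_lfunE add_lfunE scale_lfunE linearP.
pose L := GRing.isLinear.Build _ _ _ _ F lF.
pose FL : {linear _ -> _} := HB.pack F L.
exact: (lfunE FL).
Qed.

Lemma tens_map_tens (V V' W W' : vectType k) (g : 'Hom(V, V'))
    (h : 'Hom(W, W')) (v : V) (w : W) :
  tens_map g h (tens v w) = tens (g v) (h w).
Proof.
apply/lfunP=> x.
by rewrite tens_mapE !comp_lfunE !tensE dual_mapE comp_lfunE linearZ.
Qed.

(* The f (mu, mu')-th vector is e_mu (x) e'_mu'; see tens_basisE. *)
Definition tens_basis (V W : vectType k) (m n : nat)
    (f : 'I_m * 'I_n -> 'I_(m * n)) (f_bij : bijective f)
    (e : m.-tuple V) (e' : n.-tuple W) : (m * n).-tuple (tens_space V W) :=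
  [tuple let p := bij_inv f_bij i in tens (tnth e p.1) (tnth e' p.2)
    | i < (m * n)%N].

Lemma tens_basisE (V W : vectType k) (m n : nat)
    (f : 'I_m * 'I_n -> 'I_(m * n)) (f_bij : bijective f)
    (e : m.-tuple V) (e' : n.-tuple W) mu mu' :
  tnth (tens_basis f_bij e e') (f (mu, mu')) = tens (tnth e mu) (tnth e' mu').
Proof. by rewrite tnth_mktuple bij_invKV. Qed.

Lemma tens_basisP (V W : vectType k) (m n : nat)
    (f : 'I_m * 'I_n -> 'I_(m * n)) (f_bij : bijective f)
    (e : m.-tuple V) (e' : n.-tuple W) :
  basis_of {:V} e -> basis_of {:W} e' ->
  basis_of {:tens_space V W} (tens_basis f_bij e e').
Proof.
move=> eB e'B.
have dim_tens : \dim {:tens_space V W} = (m * n)%N.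
  rewrite -(size_basis eB) -(size_basis e'B) !dimvf.
  by rewrite -[LHS]/(dim V * 1 * dim W)%N muln1.
rewrite basisEfree subvf size_tuple dim_tens leqnn !andbT.
apply/freeP=> c c0 i.
rewrite -(bij_invK f_bij i); case: (bij_inv f_bij i) => mu mu'.
pose h : dualsp V := linfun (coord e mu : V -> k^o).
move/freeP: (basis_free e'B) => /(_ (fun j => c (f (mu, j)))); apply.
have := congr1 (fun T : 'Hom(dualsp V, W) => T h) c0.
rewrite zero_lfunE sum_lfunE => c0h; apply: etrans c0h.
rewrite [RHS](reindex f); last exact: onW_bij.
pose G a b := c (f (a, b)) *: ((a == mu)%:R *: e'`_b : W).
rewrite [RHS](eq_bigr (fun p => G p.1 p.2)); last first.
  case=> a b _; rewrite scale_lfunE -tnth_nth tens_basisE tensE.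
  rewrite /G -tnth_nth lfunE /= (tnth_nth 0) coord_free ?(basis_free eB) //.
rewrite -(pair_big xpredT xpredT G) /= (bigD1 mu) //= [X in _ + X]big1 => [|a].
  by rewrite addr0; apply: eq_bigr => b _; rewrite /G eqxx scale1r.
by move/negPf => neq; apply: big1 => b _; rewrite /G neq scale0r scaler0.
Qed.

End Tensor.

Definition qtensor (Q Q' : quiver) : quiver :=
  @Quiver (qvert Q * qvert Q')%type
    ((qvert Q * qarr Q') + (qarr Q * qvert Q'))%type
    (fun be => match be with
               | inl p => (p.1, qsrc p.2)
               | inr p => (qsrc p.1, p.2) end)
    (fun be => match be with
               | inl p => (p.1, qtgt p.2)
               | inr p => (qtgt p.1, p.2) end).

Definition rep_tensor (k : fieldType) (Q Q' : quiver)
    (V : qrep k Q) (W : qrep k Q') : qrep k (qtensor Q Q') :=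
  @QRep k (qtensor Q Q')
    (fun x => tens_space (rspace V x.1) (rspace W x.2))
    (fun be => match be with
               | inl p => tens_map \1%VF (rmap W p.2)
               | inr p => tens_map (rmap V p.1) \1%VF end).

Definition weight_tensor (R : realType) (Q Q' : quiver)
    (theta : qvert Q -> R) (theta' : qvert Q' -> R) :
    qvert (qtensor Q Q') -> R :=
  fun x => theta x.1 + theta' x.2.

Definition dim_tensor (Q Q' : quiver) (d : qvert Q -> nat)
    (d' : qvert Q' -> nat) : qvert (qtensor Q Q') -> nat :=
  fun x => (d x.1 * d' x.2)%N.

Definition qcover (Q : quiver) (d : qvert Q -> nat) : quiver :=
  @Quiver {a : qvert Q & 'I_(d a)}
    {al : qarr Q & ('I_(d (qsrc al)) * 'I_(d (qtgt al)))%type}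
    (fun be => Tagged (fun a => 'I_(d a)) (tagged be).1)
    (fun be => Tagged (fun a => 'I_(d a)) (tagged be).2).

Definition cover_weight (R : realType) (Q : quiver) (d : qvert Q -> nat)
    (theta : qvert Q -> R) : qvert (qcover d) -> R :=
  fun x => theta (tag x).

(* The map attached to (al, mu, nu) sends v to the component of rho_al v along
   the nu-th basis vector b; that component c *: b lies in the line <[b]>, where
   vsproj is the identity. *)
Definition cover_rep (k : fieldType) (Q : quiver) (d : qvert Q -> nat)
    (V : qrep k Q) (e : forall a, (d a).-tuple (rspace V a)) :
    qrep k (qcover d) :=
  @QRep k (qcover d)
    (fun x => subvs_of <[tnth (e (tag x)) (tagged x)]>%VS)
    (fun be =>
       let al := tag be in
       let b := tnth (e (qtgt al)) (tagged be).2 in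
       linfun (fun v : subvs_of <[tnth (e (qsrc al)) (tagged be).1]>%VS =>
         vsproj <[b]>%VS
           (coord (e (qtgt al)) (tagged be).2 (rmap V al (vsval v)) *: b))).

(* Embeddings that are bijective on vertices and injective on arrows. *)
Record qembedding (Q P : quiver) := QEmbedding {
  emb0 : qvert Q -> qvert P;
  emb1 : qarr Q -> qarr P;
  emb_src : forall al, qsrc (emb1 al) = emb0 (qsrc al);
  emb_tgt : forall al, qtgt (emb1 al) = emb0 (qtgt al);
  emb0_bij : bijective emb0;
  emb1_inj : injective emb1
}.

(* Transport of a linear map along equalities of vertices: the source of an
   embedded arrow is only propositionally the image of its source. *)
Definition cast_hom (k : fieldType) (I : Type) (F : I -> vectType k)
    (x y x' y' : I) (ex : x = x') (ey : y = y') (g : 'Hom(F x, F y)) :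
    'Hom(F x', F y') :=
  ecast z 'Hom(F z, F y') ex (ecast z 'Hom(F x, F z) ey g).

Section ForgetExtend.
Variables (k : fieldType) (Q P : quiver) (phi : qembedding Q P).

Definition forget (X : qrep k P) : qrep k Q :=
  @QRep k Q (fun x => rspace X (emb0 phi x))
    (fun al => cast_hom (emb_src phi al) (emb_tgt phi al)
                        (rmap X (emb1 phi al))).

Definition emb0_inv : qvert P -> qvert Q := bij_inv (emb0_bij phi).

Lemma emb_src_inv (be : qarr P) (al : qarr Q) :
  emb1 phi al == be -> qsrc al = emb0_inv (qsrc be).
Proof. by move/eqP <-; rewrite emb_src /emb0_inv bij_invKV. Qed.

Lemma emb_tgt_inv (be : qarr P) (al : qarr Q) :
  emb1 phi al == be -> qtgt al = emb0_inv (qtgt be).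
Proof. by move/eqP <-; rewrite emb_tgt /emb0_inv bij_invKV. Qed.

(* emb1 is injective, so at most one arrow u lies over be. *)
Definition extend0 (Y : qrep k Q) : qrep k P :=
  @QRep k P (fun y => rspace Y (emb0_inv y))
    (fun be =>
       if [pick u : {al : qarr Q | emb1 phi al == be}] is Some u then
         cast_hom (F := rspace Y) (emb_src_inv (valP u)) (emb_tgt_inv (valP u))
                  (rmap Y (val u))
       else 0).

End ForgetExtend.

Section CoverEmbedding.
Variables (Q Q' : quiver) (d : qvert Q -> nat) (d' : qvert Q' -> nat).
Variable f : forall a a', 'I_(d a) * 'I_(d' a') -> 'I_(d a * d' a').
Hypothesis f_bij : forall a a', bijective (@f a a').

Definition phi0 (x : qvert (qtensor (qcover d) (qcover d'))) :
    qvert (qcover (dim_tensor d d')) :=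
  Tagged (fun z => 'I_(dim_tensor d d' z))
    (i := (tag x.1, tag x.2)) (f (tagged x.1, tagged x.2)).

Definition phi1 (be : qarr (qtensor (qcover d) (qcover d'))) :
    qarr (qcover (dim_tensor d d')) :=
  let T (ga : qarr (qtensor Q Q')) :=
    ('I_(dim_tensor d d' (qsrc ga)) * 'I_(dim_tensor d d' (qtgt ga)))%type in
  match be with
  | inl p =>
      Tagged T (i := inl (tag p.1, tag p.2))
        (f (tagged p.1, (tagged p.2).1), f (tagged p.1, (tagged p.2).2))
  | inr p =>
      Tagged T (i := inr (tag p.1, tag p.2))
        (f ((tagged p.1).1, tagged p.2), f ((tagged p.1).2, tagged p.2))
  end.

Lemma phi_src be : qsrc (phi1 be) = phi0 (qsrc be).
Proof. by case: be => -[x y]. Qed.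

Lemma phi_tgt be : qtgt (phi1 be) = phi0 (qtgt be).
Proof. by case: be => -[x y]. Qed.

Lemma phi0_bij : bijective phi0.
Proof.
pose g (y : qvert (qcover (dim_tensor d d'))) :
    qvert (qtensor (qcover d) (qcover d')) :=
  let p := bij_inv (@f_bij (tag y).1 (tag y).2) (tagged y) in
  (Tagged (fun a => 'I_(d a)) p.1, Tagged (fun a => 'I_(d' a)) p.2).
exists g.
  by case=> -[a i] [b j]; rewrite /g /phi0 /= bij_invKV.
case=> -[a b] i; rewrite /g /phi0 /=; congr existT.
by rewrite -surjective_pairing bij_invK.
Qed.

Lemma phi1_inj : injective phi1.
Proof.
have f_inj a a' := bij_inj (@f_bij a a').
case=> [[[a i] [al [m n]]]|[[al [m n]] [a i]]];
  case=> [[[b j] [be [p q]]]|[[be [p q]] [b j]]] //= E.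
- have := congr1 (@tag _ _) E => /= -[eab ealbe].
  subst b be; move/eqP: E; rewrite eq_Tagged => /eqP /= [] /f_inj [-> ->].
  by move/f_inj => [->].
- have := congr1 (@tag _ _) E => /= -[ealbe eab].
  subst b be; move/eqP: E; rewrite eq_Tagged => /eqP /= [] /f_inj [-> ->].
  by move/f_inj => [->].
Qed.

Definition phi : qembedding (qtensor (qcover d) (qcover d'))
    (qcover (dim_tensor d d')) :=
  QEmbedding phi_src phi_tgt phi0_bij phi1_inj.

End CoverEmbedding.

(* Main.v *)
(** Every space of a covering representation is a line, and so is every space
    of a tensor product of covering representations.  A subrepresentation of a
    representation by lines is a set of vertices closed under the arrows that
    act by non-zero maps, so semistability depends only on that set of arrows,
    and having more such arrows can only help.  The matrix entry of
    1 (x) sigma from e_mu (x) e'_mu' to e_nu (x) e'_nu' is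
    delta_(mu,nu) sigma_(mu',nu'), so the non-zero arrows of the covering of
    V (x) W all lie in the subquiver, where they are the non-zero arrows of the
    tensor product of the coverings. *)
Require Import Defs.
From HB Require Import structures.
From mathcomp Require Import all_boot all_order all_algebra.
From mathcomp Require Import reals.

Set Implicit Arguments.
Unset Strict Implicit.
Unset Printing Implicit Defensive.

Import GRing.Theory.
Local Open Scope ring_scope.

(** * Vanishing and coordinates of pure tensors and of tensor products of maps *)

Section Tensor.
Variable k : fieldType.
Implicit Types V W : vectType k.

Lemma tens_eq0 V W (v : V) (w : W) : (tens v w == 0) = (v == 0) || (w == 0).
Proof.
apply/eqP/orP => [vw0|vw0]; last first.
  apply/lfunP => h; rewrite tensE zero_lfunE.
  by case: vw0 => /eqP ->; rewrite ?linear0 ?scale0r ?scaler0.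
have [|w0] := eqVneq w 0; [by right|left].
rewrite (coord_vbasis (memvf v)) big1 // => i _.
(* Evaluated at the [i]-th coordinate form, the vanishing tensor becomes the [i]-th coordinate of
   [v] times the non-zero [w]. *)
pose h : dualsp V := linfun (coord (vbasis {:V}) i : V -> k^o).
have /eqP := congr1 (fun T : 'Hom(dualsp V, W) => T h) vw0.
rewrite /= tensE zero_lfunE lfunE /= scaler_eq0 (negPf w0) orbF => /eqP ->.
exact: scale0r.
Qed.

Lemma lfun_neq0 V W (g : 'Hom(V, W)) : g != 0 -> exists v, g v != 0.
Proof.
move=> g0; have /subvPn[_ /memv_imgP[v _ ->]] : ~~ (limg g <= 0)%VS.
  rewrite subv0 -lkerE; apply: contraNN g0 => /subvP gk; apply/eqP/lfunP => v.
  by rewrite zero_lfunE; apply/eqP; rewrite -memv_ker gk ?memvf.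
by rewrite memv0; exists v.
Qed.

(** Vectors that [g] and [h] do not kill give a pure tensor that the tensor product does not
    kill. *)
Lemma tens_map_eq0 V V' W W' (g : 'Hom(V, V')) (h : 'Hom(W, W')) :
  (tens_map g h == 0) = (g == 0) || (h == 0).
Proof.
apply/idP/orP => [gh0|gh0].
  have [|/lfun_neq0[v gv]] := eqVneq g 0; [by left|right].
  apply: contraTT gh0 => /lfun_neq0[w hw].
  have : tens_map g h (tens v w) != 0 by rewrite tens_map_tens tens_eq0 negb_or gv.
  by apply: contraNneq => ->; rewrite zero_lfunE.
apply/eqP/lfunP => T; rewrite tens_mapE zero_lfunE; apply/lfunP => x.
rewrite !comp_lfunE zero_lfunE dual_mapE.
case: gh0 => /eqP ->; last by rewrite zero_lfunE.
have -> : ((x : 'Hom(V', k^o)) \o (0 : 'Hom(V, V')))%VF = 0.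
  by apply/lfunP => v; rewrite comp_lfunE !zero_lfunE linear0.
by rewrite !linear0.
Qed.

Lemma dim_tens_space V W :
  \dim {:tens_space V W} = (\dim {:V} * \dim {:W})%N.
(* The factor 1 is the dimension of [k^o], the target of linear forms. *)
Proof. by rewrite !dimvf -[LHS]/(dim V * 1 * dim W)%N muln1. Qed.

Lemma coord_basis_tnth (U : vectType k) n (b : n.-tuple U) i j :
  basis_of {:U} b -> coord b i (tnth b j) = (j == i)%:R.
Proof. by move=> bB; rewrite (tnth_nth 0) coord_free ?(basis_free bB). Qed.

Lemma coord_tens_basis V W (m n : nat)
    (f : 'I_m * 'I_n -> 'I_(m * n)) (f_bij : bijective f)
    (e : m.-tuple V) (e' : n.-tuple W) (v : V) (w : W) nu nu' :
  basis_of {:V} e -> basis_of {:W} e' ->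
  coord (tens_basis f_bij e e') (f (nu, nu')) (tens v w) =
  coord e nu v * coord e' nu' w.
Proof.
move=> eB e'B.
have tB := tens_basisP f_bij eB e'B.
(* These are the coefficients obtained by expanding [v] and [w] in their bases; freeness of the
   tensor basis makes them the coordinates. *)
pose c i := let p := bij_inv f_bij i in coord e p.1 v * coord e' p.2 w.
suff -> : tens v w = \sum_i c i *: (tens_basis f_bij e e')`_i.
  by rewrite coord_sum_free ?(basis_free tB) // /c bij_invKV.
rewrite (reindex f); last exact: onW_bij.
apply/lfunP => h; rewrite tensE sum_lfunE.
pose G a b := (coord e a v * coord e' b w) *: (h e`_a *: e'`_b).
rewrite [RHS](eq_bigr (fun p => G p.1 p.2)); last first.
  case=> a b _; rewrite scale_lfunE /c bij_invKV -tnth_nth tens_basisE tensE.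
  by rewrite /G !(tnth_nth 0).
rewrite -(pair_big xpredT xpredT G) /= {1}(coord_basis eB (memvf v)).
rewrite linear_sum /= scaler_suml; apply: eq_bigr => a _.
rewrite {1}(coord_basis e'B (memvf w)) scaler_sumr; apply: eq_bigr => b _.
rewrite /G !scalerA [in RHS]mulrAC; congr (_ * _ *: _); by rewrite [LHS]linearZ.
Qed.

End Tensor.

(** * Semistability of representations by lines, and along an embedding of quivers *)

Section Semistability.
Variables (R : realType) (k : fieldType).

Lemma semistable_lines (P : quiver) (theta : qvert P -> R) (X Y : qrep k P) :
    (forall a, \dim {:rspace X a} = 1%N) -> (forall a, \dim {:rspace Y a} = 1%N) ->
    (forall be, rmap X be = 0 -> rmap Y be = 0) ->
  semistable theta Y -> semistable theta X.
Proof.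
move=> dX dY XY [[a0 _] ssY]; split=> [|U subU [a Ua] [b Ub]].
  by exists a0; rewrite -dimv_eq0 dX.
have U_line x : U x != 0%VS -> U x = fullv.
  by move=> Ux; apply/eqP; rewrite eqEdim subvf dX lt0n dimv_eq0.
(* [U] is zero or full at each vertex; [U'] is the same set of vertices read in [Y], so dimensions
   and slopes agree. *)
pose U' x : {vspace rspace Y x} := if U x == 0%VS then 0%VS else fullv.
have dU' x : \dim (U x) = \dim (U' x).
  rewrite /U'; case: eqVneq => [->|/U_line ->]; first by rewrite !dimv0.
  by rewrite dX dY.
have -> : slope theta (fun a => \dim (U a)) = slope theta (fun a => \dim (U' a)).
  by rewrite /slope; congr (_ / _); apply: eq_bigr => x _; rewrite dU'.
have -> : slope theta (fun a => \dim {:rspace X a}) =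
          slope theta (fun a => \dim {:rspace Y a}).
  by rewrite /slope; congr (_ / _); apply: eq_bigr => x _; rewrite dX dY.
apply: ssY.
- move=> be; rewrite /U'.
  case: (eqVneq (U (qsrc be)) 0%VS) => [_|Us]; first by rewrite limg0 sub0v.
  case: eqVneq => [Ut|_]; last exact: subvf.
  (* An arrow leaving the vertex set must act by zero on [X], hence by hypothesis on [Y]. *)
  have := subU be; rewrite (U_line _ Us) Ut subv0 => /eqP X0.
  rewrite XY ?lim0g ?subvv //; apply/lfunP => v; rewrite zero_lfunE.
  by apply/eqP; rewrite -memv0 -X0 memv_img ?memvf.
- by exists a; rewrite -dimv_eq0 -dU' dimv_eq0.
- exists b; rewrite /U' ifT -?dimv_eq0 ?dimv0; last first.
    by rewrite dimv_eq0; apply: contraNT Ub => /U_line ->.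
  by rewrite eq_sym -dimv_eq0 dY.
Qed.

Section Embedding.
Variables (Q P : quiver) (phi : qembedding Q P).

(** The subspaces are taken as a family over [I], so that eliminating the equalities of indices
    moves them together with the spaces. *)
Lemma limg_cast_hom (I : Type) (F : I -> vectType k) (x y x' y' : I)
    (ex : x = x') (ey : y = y') (g : 'Hom(F x, F y))
    (U : forall i, {vspace F i}) :
  (g @: U x <= U y)%VS -> (cast_hom ex ey g @: U x' <= U y')%VS.
Proof. by case: _ / ex; case: _ / ey. Qed.

Lemma cast_hom_eq0 (I : Type) (F : I -> vectType k) (x y x' y' : I)
    (ex : x = x') (ey : y = y') (g : 'Hom(F x, F y)) :
  (cast_hom ex ey g == 0) = (g == 0).
Proof. by case: _ / ex; case: _ / ey. Qed.

Lemma slope_emb (theta : qvert P -> R) (n : qvert P -> nat) :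
  slope (theta \o emb0 phi) (n \o emb0 phi) = slope theta n.
Proof.
by rewrite /slope [in RHS](reindex (emb0 phi)) ?[X in _ = _ / X](reindex (emb0 phi));
  try exact/onW_bij/emb0_bij.
Qed.

(** Forgetting arrows keeps every subrepresentation and, by bijectivity on vertices, its slope;
    semistability is thus tested on at least as many families after forgetting. *)
Lemma semistable_forget (theta : qvert P -> R) (X : qrep k P) :
  semistable (theta \o emb0 phi) (forget phi X) -> semistable theta X.
Proof.
case=> -[a0 a0P] ssX; split=> [|U subU [a Ua] [b Ub]].
  by exists (emb0 phi a0).
rewrite -!slope_emb.
apply: (ssX (fun x => U (emb0 phi x))).
- by move=> al; apply: (@limg_cast_hom _ (rspace X) _ _ _ _ _ _ _ U); apply: subU.
- by rewrite -(bij_invK (emb0_bij phi) a) in Ua; exists (emb0_inv phi a).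
- by rewrite -(bij_invK (emb0_bij phi) b) in Ub; exists (emb0_inv phi b).
Qed.

Lemma rmap_extend0_emb (Y : qrep k Q) (al : qarr Q) :
  (rmap (extend0 phi Y) (emb1 phi al) == 0) = (rmap Y al == 0).
Proof.
(* The search cannot fail, since [al] itself is a candidate; injectivity on arrows shows that the
   arrow found is [al]. *)
rewrite /=; case: pickP => [u _|/(_ (exist _ al (eqxx _)))] //.
rewrite cast_hom_eq0; case: u => u /= /eqP.
by move/emb1_inj ->.
Qed.

Lemma rmap_extend0_out (Y : qrep k Q) (be : qarr P) :
  be \notin codom (emb1 phi) -> rmap (extend0 phi Y) be = 0.
Proof.
move=> bePhi /=; case: pickP => [u _|//].
by case/negP: bePhi; rewrite -(eqP (valP u)) codom_f.
Qed.

End Embedding.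
End Semistability.

(** * Maps of a covering representation as matrix entries *)

Section Cover.
Variables (k : fieldType) (Q : quiver) (d : qvert Q -> nat) (V : qrep k Q).
Variable e : forall a, (d a).-tuple (rspace V a).
Hypothesis e_basis : forall a, basis_of {:rspace V a} (e a).

Lemma tnth_basis_neq0 a mu : tnth (e a) mu != 0.
Proof.
exact: free_not0 (basis_free (e_basis a)) (mem_tnth mu (e a)).
Qed.

Lemma dim_cover_rep x : \dim {:rspace (cover_rep e) x} = 1%N.
Proof. by rewrite dimvf /dim /= dim_vline tnth_basis_neq0. Qed.

Lemma rmap_coverE (be : qarr (qcover d))
    (v : rspace (cover_rep e) (qsrc be)) :
  vsval (rmap (cover_rep e) be v) =
  coord (e (qtgt (tag be))) (tagged be).2 (rmap V (tag be) (vsval v)) *: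
    tnth (e (qtgt (tag be))) (tagged be).2.
Proof.
case: be v => al [mu nu] /= v.
set b := tnth (e (qtgt al)) nu.
(* [linfun] agrees with the underlying function only once that function is known to be linear. *)
pose F (v : subvs_of <[tnth (e (qsrc al)) mu]>%VS) :=
  vsproj <[b]>%VS (coord (e (qtgt al)) nu (rmap V al (vsval v)) *: b).
have F_lin : linear F.
  by move=> c x y; rewrite /F !linearP /= scalerDl -scalerA linearP.
pose FL : {linear _ -> _} := HB.pack F (GRing.isLinear.Build _ _ _ _ F F_lin).
by rewrite (lfunE FL) /= vsprojK ?memvZ ?memv_line.
Qed.

(** The source is the line through a basis vector, so the image of that vector decides; it is the
    matrix entry times a non-zero vector. *)
Lemma rmap_cover_eq0 (be : qarr (qcover d)) :
  (rmap (cover_rep e) be == 0) =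
  (coord (e (qtgt (tag be))) (tagged be).2
     (rmap V (tag be) (tnth (e (qsrc (tag be))) (tagged be).1)) == 0).
Proof.
apply/eqP/eqP => [be0|c0].
  pose v : rspace (cover_rep e) (qsrc be) :=
    vsproj _ (tnth (e (qsrc (tag be))) (tagged be).1).
  have := rmap_coverE v; rewrite be0 zero_lfunE vsprojK ?memv_line //= => /esym/eqP.
  by rewrite scaler_eq0 (negPf (tnth_basis_neq0 _)) orbF => /eqP.
apply/lfunP => v; rewrite zero_lfunE; apply: val_inj; rewrite /= rmap_coverE.
have /vlineP[c ->] := valP v.
by rewrite !linearZ /= c0 mulr0 scale0r.
Qed.

End Cover.

(** The other tensor factor is the identity of a line, which is non-zero. *)
Lemma rmap_rep_tensor_eq0 (k : fieldType) (Q Q' : quiver)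
    (X : qrep k Q) (Y : qrep k Q')
    (dX : forall a, \dim {:rspace X a} = 1%N)
    (dY : forall a, \dim {:rspace Y a} = 1%N) (be : qarr (qtensor Q Q')) :
  (rmap (rep_tensor X Y) be == 0) =
  match be with inl p => rmap Y p.2 == 0 | inr p => rmap X p.1 == 0 end.
Proof.
have id0 (Z : vectType k) : \dim {:Z} = 1%N -> ((\1%VF : 'End(Z)) == 0) = false.
  by move=> dZ; apply/eqP => id0; move: dZ; rewrite -(lim1g {:Z}) id0 lim0g dimv0.
by case: be => p /=; rewrite tens_map_eq0 id0 ?orbF.
Qed.

(** * Non-zero arrows of the covering of a tensor product *)

Section TensorCover.
Variables (k : fieldType) (Q Q' : quiver).
Variables (d : qvert Q -> nat) (d' : qvert Q' -> nat).
Variable f : forall a a', 'I_(d a) * 'I_(d' a') -> 'I_(d a * d' a').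
Hypothesis f_bij : forall a a', bijective (@f a a').
Variables (V : qrep k Q) (W : qrep k Q').
Variable e : forall a, (d a).-tuple (rspace V a).
Variable e' : forall a', (d' a').-tuple (rspace W a').
Hypothesis e_basis : forall a, basis_of {:rspace V a} (e a).
Hypothesis e'_basis : forall a', basis_of {:rspace W a'} (e' a').

Let tens_bases (x : qvert (qtensor Q Q')) :
    (dim_tensor d d' x).-tuple (rspace (rep_tensor V W) x) :=
  tens_basis (@f_bij x.1 x.2) (e x.1) (e' x.2).

Lemma tens_bases_basis x : basis_of {:rspace (rep_tensor V W) x} (tens_bases x).
Proof. exact: tens_basisP. Qed.

(** Along an arrow in the image of [phi1] the index in the identity factor does not change, so the
    Kronecker delta is 1 and the other factor's entry remains. *)
Lemma rmap_cover_tensor_phi1 (be : qarr (qtensor (qcover d) (qcover d'))) :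
  (rmap (cover_rep tens_bases) (phi1 (@f) be) == 0) =
  match be with
  | inl p => rmap (cover_rep e') p.2 == 0
  | inr p => rmap (cover_rep e) p.1 == 0
  end.
Proof.
rewrite rmap_cover_eq0; last exact: tens_bases_basis.
case: be => -[[a x] [b y]]; rewrite rmap_cover_eq0 //=.
  rewrite tens_basisE tens_map_tens coord_tens_basis // id_lfunE.
  by rewrite coord_basis_tnth // eqxx mul1r.
rewrite tens_basisE tens_map_tens coord_tens_basis // id_lfunE.
by rewrite coord_basis_tnth // eqxx mulr1.
Qed.

Lemma rmap_cover_tensor_codom (be : qarr (qcover (dim_tensor d d'))) :
  rmap (cover_rep tens_bases) be != 0 -> be \in codom (phi1 (@f)).
Proof.
rewrite rmap_cover_eq0; last exact: tens_bases_basis.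
case: be => -[[a al]|[al a]] [m n] /=.
  (* Surjectivity of [f] turns both indices into pairs; the entry then carries the delta of [mu] and
     [nu], and if these agree the arrow visibly comes from the tensor product of the coverings. *)
  rewrite -(bij_invK (@f_bij _ _) m) -(bij_invK (@f_bij _ _) n).
  move: (bij_inv _ m) (bij_inv _ n) => [mu mu'] [nu nu'] /=.
  rewrite tens_basisE tens_map_tens coord_tens_basis // id_lfunE.
  rewrite coord_basis_tnth //; case: (eqVneq mu nu) => [-> _|_]; last by rewrite mul0r eqxx.
  apply/codomP; exists (inl (Tagged (fun a => 'I_(d a)) nu,
    Tagged (fun al => ('I_(d' (qsrc al)) * 'I_(d' (qtgt al)))%type) (mu', nu'))).
  by [].
rewrite -(bij_invK (@f_bij _ _) m) -(bij_invK (@f_bij _ _) n).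
move: (bij_inv _ m) (bij_inv _ n) => [mu mu'] [nu nu'] /=.
rewrite tens_basisE tens_map_tens coord_tens_basis // id_lfunE.
rewrite coord_basis_tnth //; case: (eqVneq mu' nu') => [-> _|_]; last by rewrite mulr0 eqxx.
apply/codomP; exists (inr (
  Tagged (fun al => ('I_(d (qsrc al)) * 'I_(d (qtgt al)))%type) (mu, nu),
  Tagged (fun a => 'I_(d' a)) nu')).
by [].
Qed.

(** On the image of [phi1] both maps vanish exactly when the same factor entry does; off it both are
    zero. *)
Lemma rmap_extend0_cover_tensor_eq0 (be : qarr (qcover (dim_tensor d d'))) :
  (rmap (extend0 (phi f_bij) (rep_tensor (cover_rep e) (cover_rep e'))) be == 0) =
  (rmap (cover_rep tens_bases) be == 0).
Proof.
have [/codomP[al ->]|be_out] := boolP (be \in codom (phi1 (@f))).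
  rewrite (rmap_extend0_emb (phi f_bij)) rmap_cover_tensor_phi1.
  by rewrite rmap_rep_tensor_eq0 //; exact: dim_cover_rep.
rewrite (rmap_extend0_out (phi := phi f_bij)) // eqxx; apply/esym.
by apply: contraNT be_out; exact: rmap_cover_tensor_codom.
Qed.

Lemma dim_extend0_cover_tensor x :
  \dim {:rspace (extend0 (phi f_bij)
    (rep_tensor (cover_rep e) (cover_rep e'))) x} = 1%N.
Proof. by rewrite /= dim_tens_space !dim_cover_rep. Qed.

End TensorCover.

Theorem proposition4p6 (R : realType) (k : fieldType) (Q Q' : quiver)
    (hQ : (0 < #|qvert Q|)%N) (hQ' : (0 < #|qvert Q'|)%N)
    (theta : qvert Q -> R) (theta' : qvert Q' -> R)
    (d : qvert Q -> nat) (d' : qvert Q' -> nat)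
    (f : forall (a : qvert Q) (a' : qvert Q'),
           'I_(d a) * 'I_(d' a') -> 'I_(d a * d' a'))
    (f_bij : forall (a : qvert Q) (a' : qvert Q'), bijective (f a a'))
    (V : qrep k Q) (W : qrep k Q')
    (hV : has_type V d) (hW : has_type W d')
    (e : forall a : qvert Q, (d a).-tuple (rspace V a))
    (e' : forall a' : qvert Q', (d' a').-tuple (rspace W a'))
    (e_basis : forall a : qvert Q, basis_of {:rspace V a} (e a))
    (e'_basis : forall a' : qvert Q', basis_of {:rspace W a'} (e' a')) :
  let VWcov : qrep k (qcover (dim_tensor d d')) :=
    cover_rep (V := rep_tensor V W) (d := dim_tensor d d')
      (fun x => tens_basis (f_bij x.1 x.2) (e x.1) (e' x.2)) in
  let emb := phi f_bij in
  (semistable (weight_tensor (cover_weight (d := d) theta)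
                             (cover_weight (d := d') theta'))
              (forget emb VWcov) ->
   semistable (cover_weight (weight_tensor theta theta')) VWcov) /\
  (semistable (cover_weight (weight_tensor theta theta'))
              (extend0 emb (rep_tensor (cover_rep e) (cover_rep e'))) <->
   semistable (cover_weight (weight_tensor theta theta')) VWcov).
Proof.
move=> VWcov emb.
have dVW x : \dim {:rspace VWcov x} = 1%N.
  by apply: dim_cover_rep => a; exact: tens_bases_basis.
have dI := dim_extend0_cover_tensor f_bij e_basis e'_basis.
have map0 := rmap_extend0_cover_tensor_eq0 f_bij e_basis e'_basis.
split; first exact: (@semistable_forget _ _ _ _ emb).
(* Both are representations by lines with the same zero arrows, so the comparison applies in each
   direction. *)
by split; apply: semistable_lines => // be be0; apply/eqP;
  [rewrite map0|rewrite -map0]; exact/eqP.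
Qed.
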